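(* Let $n\ge 1$ and let $I\subset\mathbb{N}^n$ be finite and nonempty. Then there is a finite, possibly empty, set of primes $S$ satisfying one of the following: (a) for every algebraically closed field $K$, $Z_I(K)=\emptyset$ if and only if $\operatorname{char}K\in S$; (b) for every algebraically closed field $K$, $Z_I(K)=\emptyset$ if and only if $\operatorname{char}K\notin S$.
   Context: $\mathbb{N}$ denotes the set of all non-negative integers (including $0$). For $i=(i_1,\dots,i_n)\in\mathbb{N}^n$, $X^i=X_1^{i_1}\cdots X_n^{i_n}$. For a field $K$, the support of $P\in K[X]=K[X_1,\dots,X_n]$ is the finite set $I(P)\subset\mathbb{N}^n$ such that $P=\sum_{i\in I(P)}a_iX^i$ with all $a_i\in K\setminus\{0\}$. A polynomial is reducible (decomposable) if it is a product of two nonconstant polynomials in $K[X]$; in particular nonzero constants are not reducible. For finite nonempty $I\subset\mathbb{N}^n$, $Z_I(K)=\{P\in K[X]\mid I(P)=I,\ P\text{ is reducible}\}$. *)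

(* Defs.v *)
From HB Require Import structures.
From mathcomp Require Import all_boot all_order all_algebra.
From mathcomp Require Import finmap mpoly.

Set Implicit Arguments.
Unset Strict Implicit.
Unset Printing Implicit Defensive.

Local Open Scope ring_scope.

Section Reducible.
Variables (n : nat) (K : fieldType).

Definition nonconstant (P : {mpoly K[n]}) : Prop := ~ exists c : K, P = c%:MP.

Definition mpoly_reducible (P : {mpoly K[n]}) : Prop :=
  exists A B : {mpoly K[n]}, [/\ nonconstant A, nonconstant B & P = A * B].

(* The support of P is exactly I: [msupp P] enumerates the monomials whose
   coefficient in P is nonzero, and only membership in that list matters. *)
Definition has_support (I : {fset 'X_{1..n}}) (P : {mpoly K[n]}) : Prop :=
  msupp P =i I.

Definition Z (I : {fset 'X_{1..n}}) (P : {mpoly K[n]}) : Prop :=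
  has_support I P /\ mpoly_reducible P.

End Reducible.

Definition Z_empty (n : nat) (I : {fset 'X_{1..n}}) (K : fieldType) : Prop :=
  forall P : {mpoly K[n]}, ~ Z I P.

(* [pchar K] is the set of primes equal to 0 in K: empty in characteristic 0,
   the singleton of the characteristic otherwise. As S will consist of primes,
   characteristic 0 never belongs to it. *)
Definition char_in (K : fieldType) (S : {fset nat}) : Prop :=
  exists2 p : nat, p \in S & p \in [pchar K].

(* Main.v *)
Require Import Defs.
From HB Require Import structures.
From mathcomp Require Import all_boot all_order all_algebra.
From mathcomp Require Import finmap mpoly.

(* If [P = A * B] has support [I], then the degrees of [A] and [B] are bounded by
   that of [I], so that [Z_I(K)] is nonempty iff a system of equations and
   inequations with integer coefficients, in the coefficients of [A] and [B], has
   a solution in [K]. Eliminating these unknowns one at a time, uniformly in the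
   algebraically closed field [K], leaves a boolean combination of conditions
   [c = 0] in [K] with [c] an integer; each of them holds either in every
   characteristic ([c = 0]) or exactly in the characteristics dividing [c]. *)

Set Implicit Arguments.
Unset Strict Implicit.
Unset Printing Implicit Defensive.

Import GRing.Theory.
Local Open Scope ring_scope.

(** * Quantifier-free formulas and their disjunctive normal form *)

(** Atoms are elements of a ring, read in a field [K] only through a map [h], so that one formula
    can be evaluated in all fields. They come in both signs, which replaces a negation. *)
Inductive form (R : Type) : Type :=
  | Eq0 of R
  | Neq0 of R
  | And of form R & form R
  | Or of form R & form R.

Fixpoint eval (R : Type) (K : fieldType) (h : R -> K) (a : form R) : bool :=
  match a with
  | Eq0 r => h r == 0
  | Neq0 r => h r != 0
  | And b c => eval h b && eval h c
  | Or b c => eval h b || eval h c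
  end.

Definition big_and (R : nzRingType) : seq (form R) -> form R :=
  foldr (@And R) (Eq0 0).
Definition big_or (R : nzRingType) : seq (form R) -> form R :=
  foldr (@Or R) (Neq0 0).

Lemma eval_big_and (R : nzRingType) (K : fieldType) (h : {rmorphism R -> K})
  (s : seq (form R)) : eval h (big_and s) = all (eval h) s.
Proof. by elim: s => [|a s IHs] /=; rewrite ?rmorph0 ?eqxx ?IHs. Qed.

Lemma eval_big_or (R : nzRingType) (K : fieldType) (h : {rmorphism R -> K})
  (s : seq (form R)) : eval h (big_or s) = has (eval h) s.
Proof. by elim: s => [|a s IHs] /=; rewrite ?rmorph0 ?eqxx ?IHs. Qed.

(** One inequation per clause suffices: in a field, several elements are all nonzero iff their
    product is. *)
Definition eval_clause (R : Type) (K : fieldType) (h : R -> K)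
  (c : seq R * R) : bool := all (fun f => h f == 0) c.1 && (h c.2 != 0).

Fixpoint dnf (R : nzRingType) (a : form R) : seq (seq R * R) :=
  match a with
  | Eq0 r => [:: ([:: r], 1)]
  | Neq0 r => [:: ([::], r)]
  | And b c => [seq (u.1 ++ v.1, u.2 * v.2) | u <- dnf b, v <- dnf c]
  | Or b c => dnf b ++ dnf c
  end.

Lemma eval_dnf (R : nzRingType) (K : fieldType) (h : {rmorphism R -> K})
  (a : form R) : has (eval_clause h) (dnf a) = eval h a.
Proof.
elim: a => [r|r|b IHb c IHc|b IHb c IHc] /=.
- by rewrite /eval_clause /= rmorph1 oner_eq0 !andbT orbF.
- by rewrite /eval_clause /= orbF.
- rewrite -IHb -IHc; apply/hasP/andP => [[w]|[/hasP[u ub eu] /hasP[v vc ev]]].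
    case/allpairsP => -[u v] /= [ub vc ->].
    rewrite /eval_clause /= all_cat rmorphM mulf_eq0 negb_or.
    case/andP => /andP[u1 v1] /andP[u2 v2].
    by split; apply/hasP; [exists u|exists v] => //; apply/andP.
  exists (u.1 ++ v.1, u.2 * v.2); first by apply/allpairsP; exists (u, v).
  move: eu ev; rewrite /eval_clause /= all_cat rmorphM mulf_eq0 negb_or.
  by move=> /andP[-> ->] /andP[-> ->].
- by rewrite has_cat IHb IHc.
Qed.

(* Multiplicities of roots of [f] are at most [size f]. *)
Lemma Ndvdp_exp_rootP (K : closedFieldType) (f g : {poly K}) : f != 0 ->
  reflect (exists2 x, root f x & ~~ root g x) (~~ (f %| g ^+ size f)).
Proof.
move=> f0; apply: (iffP idP) => [|[x fx]]; last first.
  apply: contra => fg; have : root (g ^+ size f) x.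
    by rewrite -dvdp_XsubCl (dvdp_trans _ fg) // dvdp_XsubCl.
  by rewrite !rootE horner_exp expf_eq0 => /andP[].
have [r fE] := closed_field_poly_normal f.
have lc0 : lead_coef f != 0 by rewrite lead_coef_eq0.
have szf : size f = (size r).+1.
  by rewrite {1}fE size_scale // size_prod_XsubC.
have [rg|/allPn[x xr gx] _] := boolP (all (root g) r); last first.
  by exists x => //; rewrite fE rootZ // root_prod_XsubC.
(* If every root of [f] is a root of [g], each factor ['X - x] of [f], counted with multiplicity, is
   matched with one factor [g]. *)
case/negP; rewrite szf fE dvdpZl // (@dvdp_trans _ (g ^+ size r)) ?dvdp_exp2l //.
elim: r rg {fE szf} => [|x r IHr] /=; first by rewrite big_nil dvd1p.
by case/andP=> gx /IHr{}IHr; rewrite big_cons exprS dvdp_mul // dvdp_XsubCl.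
Qed.

(** * Elimination of one variable *)

Section EliminateVariable.
Variable R : idomainType.
Implicit Types (f g : {poly R}) (fs : seq {poly R}).

Definition eval_at (K : fieldType) (phi : {rmorphism R -> K}) (x : K) :
  {rmorphism {poly R} -> K} := horner_morph (fun a => mulrC x (phi a)).

Lemma eval_atE (K : fieldType) (phi : {rmorphism R -> K}) (x : K) f :
  eval_at phi x f = (map_poly phi f).[x].
Proof. by []. Qed.

Definition solvable (K : fieldType) (phi : {rmorphism R -> K}) fs g : Prop :=
  exists x, eval_clause (eval_at phi x) (fs, g).

Definition some_coef_neq0 f : form R := big_or [seq Neq0 c | c <- f].

Lemma eval_some_coef_neq0 (K : fieldType) (phi : {rmorphism R -> K}) f :
  eval phi (some_coef_neq0 f) = (map_poly phi f != 0).
Proof.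
rewrite /some_coef_neq0 eval_big_or has_map; apply/hasP/idP => /=.
  case=> c /(nthP 0)[i _ <-] ci0; apply/eqP => /polyP/(_ i).
  by rewrite coef_map coef0 => /eqP; rewrite (negPf ci0).
move=> f0; exists (f`_(size (map_poly phi f)).-1).
  apply: mem_nth; rewrite (leq_trans _ (size_poly (size f) (fun i => phi f`_i))) //.
  by rewrite -[X in (_ < X)%N]/(size (map_poly phi f)) prednK // size_poly_gt0.
by rewrite -coef_map -/(lead_coef _) lead_coef_eq0.
Qed.

Definition drop_lead f : {poly R} := \poly_(i < (size f).-1) f`_i.

Lemma size_drop_lead f : f != 0 -> (size (drop_lead f) < size f)%N.
Proof.
by move=> f0; rewrite -[X in (_ < X)%N]prednK ?size_poly_gt0 // ltnS size_poly.
Qed.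

Lemma map_drop_lead (K : fieldType) (phi : {rmorphism R -> K}) f :
  phi (lead_coef f) = 0 -> map_poly phi (drop_lead f) = map_poly phi f.
Proof.
move=> lc0; apply/polyP => i; rewrite !coef_map coef_poly.
case: ltngtP => // [lt_fi|i_lead]; last first.
  by rewrite i_lead raddf0; apply/esym.
by rewrite nth_default // (leq_trans (leqSpred _) lt_fi).
Qed.

(** An algebraically closed field is infinite, so every nonzero polynomial has a non-root. *)
Lemma solvable_nil (K : closedFieldType) (phi : {rmorphism R -> K}) g :
  solvable phi [::] g <-> map_poly phi g != 0.
Proof.
by split=> [[x gx]|/closed_nonrootP[x gx]];
  [apply/closed_nonrootP|]; exists x.
Qed.

(** As [phi] keeps the leading coefficient of [f] nonzero, pseudo-division over [R] still detects
    divisibility over [K]; then [Ndvdp_exp_rootP] applies to the images of [f] and [g]. *)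
Lemma solvable_seq1 (K : closedFieldType) (phi : {rmorphism R -> K}) f g :
  phi (lead_coef f) != 0 ->
  solvable phi [:: f] g <-> map_poly phi ((g ^+ size f) %% f) != 0.
Proof.
move=> lc0; have szf : size (map_poly phi f) = size f by apply: size_map_poly_id0.
have f0 : f != 0 by apply: contraNneq lc0 => ->; rewrite lead_coef0 rmorph0.
have pf0 : map_poly phi f != 0 by rewrite -size_poly_gt0 szf size_poly_gt0.
have modE : (map_poly phi ((g ^+ size f) %% f) == 0) =
    (map_poly phi f %| map_poly phi g ^+ size f).
  have /(congr1 (map_poly phi)) := Pdiv.Idomain.divp_eq (g ^+ size f) f.
  rewrite map_polyZ rmorphXn rmorphD rmorphM /= rmorphXn /= => E.
  rewrite -(@dvdpZr _ (phi (lead_coef f) ^+ scalp (g ^+ size f) f)) ?expf_neq0 //.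
  rewrite E dvdp_addr ?dvdp_mull //; apply/eqP/idP => [->|]; first exact: dvdp0.
  move=> div; apply/eqP; apply: contraTT div => r0.
  (* The image of the remainder is smaller than that of [f], whose size has not dropped, so it is a
     multiple of it only if zero. *)
  rewrite gtNdvdp // szf (leq_ltn_trans (size_poly _ _)) //.
  by rewrite ltn_modp.
rewrite modE -szf; split=> [[x /andP[/= /andP[fx _] gx]]|].
  by apply/(Ndvdp_exp_rootP _ pf0); exists x.
by case/(Ndvdp_exp_rootP _ pf0) => x fx gx; exists x;
  apply/andP; split; rewrite //= andbT.
Qed.

Lemma eq_solvable (K : fieldType) (phi : {rmorphism R -> K}) fs fs' g :
  (forall x, all (fun f => (map_poly phi f).[x] == 0) fs =
             all (fun f => (map_poly phi f).[x] == 0) fs') ->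
  solvable phi fs g <-> solvable phi fs' g.
Proof.
move=> eq_fs; split=> -[x /andP[/= fsx gx]]; exists x; apply/andP; split=> //=.
  by rewrite -[all _ _]eq_fs.
by rewrite -[all _ _]/(all (fun f => (map_poly phi f).[x] == 0) fs) eq_fs.
Qed.

(* Over the locus where the leading coefficient of some [f] vanishes, [f] may
   be truncated; elsewhere, the other equations may be reduced modulo [f]. *)
Lemma solvable_form fs g : exists b : form R,
  forall (K : closedFieldType) (phi : {rmorphism R -> K}),
    solvable phi fs g <-> eval phi b.
Proof.
(* The successor makes the measure decrease even when a zero polynomial is discarded. *)
have [m] := ubnP (\sum_(f <- fs) (size f).+1); elim: m fs => // m IHm fs.
have drop0 fs' : (\sum_(f <- 0%R :: fs') (size f).+1 < m.+1)%N -> exists b : form R,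
    forall (K : closedFieldType) (phi : {rmorphism R -> K}),
    solvable phi (0 :: fs') g <-> eval phi b.
  rewrite big_cons size_poly0 add1n => /IHm[b bP]; exists b => K phi.
  by rewrite -bP; apply: eq_solvable => x /=; rewrite rmorph0 horner0 eqxx.
have split_lead f fs' : f != 0 -> (\sum_(f <- f :: fs') (size f).+1 < m.+1)%N ->
    (exists b : form R, forall (K : closedFieldType) (phi : {rmorphism R -> K}),
      phi (lead_coef f) != 0 -> solvable phi (f :: fs') g <-> eval phi b) ->
    exists b : form R, forall (K : closedFieldType) (phi : {rmorphism R -> K}),
      solvable phi (f :: fs') g <-> eval phi b.
  move=> f0; rewrite big_cons => lt_m [b1 b1P].
  have [|b0 b0P] := IHm (drop_lead f :: fs').
    by rewrite big_cons -ltnS (leq_trans _ lt_m) // ltnS ltn_add2r ltnS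
      size_drop_lead.
  exists (Or (And (Eq0 (lead_coef f)) b0) (And (Neq0 (lead_coef f)) b1)).
  move=> K phi /=; have [lc0|lc0] := eqVneq (phi (lead_coef f)) 0 => /=.
    by rewrite orbF -b0P; apply: eq_solvable => x /=; rewrite map_drop_lead.
  exact: b1P.
have reduce f1 f2 fs' : f1 != 0 -> (size f1 <= size f2)%N ->
    (\sum_(f <- [:: f1, f2 & fs']) (size f).+1 < m.+1)%N ->
    exists b : form R, forall (K : closedFieldType) (phi : {rmorphism R -> K}),
      solvable phi [:: f1, f2 & fs'] g <-> eval phi b.
  move=> f1_0 le_f12 lt_m; apply: split_lead => //.
  have [|b bP] := IHm [:: f1, f2 %% f1 & fs'].
    move: lt_m; rewrite !big_cons ltnS; apply: leq_trans.
    by rewrite ltn_add2l ltn_add2r ltnS (leq_trans _ le_f12) // ltn_modp.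
  exists b => K phi lc0; rewrite -bP; apply: eq_solvable => x /=.
  have [f1x|//] := eqVneq; rewrite !andTb; congr (_ && _).
  (* At a root of [f1], the remainder takes the value of [f2] times a power of the leading
     coefficient, which is nonzero in [K]. *)
  have /(congr1 (fun p => (map_poly phi p).[x])) := Pdiv.Idomain.divp_eq f2 f1.
  rewrite map_polyZ rmorphXn rmorphD rmorphM /= hornerZ hornerD hornerM f1x.
  by rewrite mulr0 add0r => <-; rewrite mulf_eq0 expf_eq0 (negPf lc0) andbF.
case: fs => [_|f1 fs].
  exists (some_coef_neq0 g) => K phi.
  by rewrite eval_some_coef_neq0; apply: solvable_nil.
have [->|f1_0] := eqVneq f1 0; first exact: drop0.
case: fs => [lt_m|f2 fs lt_m].
  apply: split_lead => //; exists (some_coef_neq0 ((g ^+ size f1) %% f1)).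
  move=> K phi lc0.
  by rewrite eval_some_coef_neq0; apply: solvable_seq1.
(* The order of the equations is irrelevant, so the smaller of the first two can serve as
   divisor. *)
have swap (K : closedFieldType) (phi : {rmorphism R -> K}) :
    solvable phi [:: f2, f1 & fs] g <-> solvable phi [:: f1, f2 & fs] g.
  by apply: eq_solvable => x /=; rewrite andbCA.
have lt_m' : (\sum_(f <- [:: f2, f1 & fs]) (size f).+1 < m.+1)%N.
  by move: lt_m; rewrite !big_cons addnCA.
have [f2_0|f2_0] := eqVneq f2 0.
  have [|b bP] := drop0 (f1 :: fs); first by rewrite -f2_0.
  by exists b => K phi; rewrite -swap f2_0.
have [/reduce|/ltnW/reduce] := leqP (size f1) (size f2); first exact.
by case/(_ _ f2_0 lt_m') => b bP; exists b => K phi; rewrite -swap.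
Qed.

(** The existential quantifier distributes over disjunction, so the clauses of the normal form are
    treated separately. *)
Lemma eliminate_exists (a : form {poly R}) : exists b : form R,
  forall (K : closedFieldType) (phi : {rmorphism R -> K}),
    (exists x, eval (eval_at phi x) a) <-> eval phi b.
Proof.
suff [b bP] : exists b : form R,
    forall (K : closedFieldType) (phi : {rmorphism R -> K}),
    (exists x, has (eval_clause (eval_at phi x)) (dnf a)) <-> eval phi b.
  by exists b => K phi; rewrite -bP; split=> -[x xP]; exists x;
    move: xP; rewrite eval_dnf.
elim: (dnf a) => [|[fs g] cs [b bP]] /=.
  by exists (Neq0 0) => K phi; rewrite /= rmorph0 eqxx; split=> // -[].
have [c cP] := solvable_form fs g.
exists (Or c b) => K phi /=; split=> [[x /orP[cx|bx]]|/orP[/cP[x cx]|/bP[x bx]]].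
- by apply/orP; left; apply/cP; exists x.
- by apply/orP; right; apply/bP; exists x.
- by exists x; rewrite cx.
- by exists x; rewrite bx orbT.
Qed.

End EliminateVariable.

(** * Iterated polynomial rings over the integers and elimination of all variables *)

Fixpoint int_poly (k : nat) : idomainType :=
  if k is k'.+1 then {poly int_poly k'} else int.

(** The head of [e] is the value of the outermost variable, the first to be eliminated. Missing
    values default to 0, so a list of any length is a valuation. *)
Fixpoint eval_int_poly (K : fieldType) (k : nat) (e : seq K) :
    {rmorphism int_poly k -> K} :=
  match k with
  | 0 => intr
  | k'.+1 => eval_at (eval_int_poly k' (behead e)) (head 0 e)
  end.

Fixpoint var (k i : nat) : int_poly k :=
  match k, i with
  | 0, _ => 0
  | k'.+1, 0 => 'X
  | k'.+1, i'.+1 => (var k' i')%:P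
  end.

Lemma eval_var (K : fieldType) (k i : nat) (e : seq K) : (i < k)%N ->
  eval_int_poly k e (var k i) = e`_i.
Proof.
elim: k i e => // k IHk [|i] e lt_ik; rewrite [LHS]eval_atE /=.
  by rewrite map_polyX hornerX; case: e.
by rewrite map_polyC hornerC [LHS]IHk // nth_behead.
Qed.

Lemma eliminate_all (k : nat) (a : form (int_poly k)) : exists b : form int,
  forall K : closedFieldType,
    (exists e : seq K, eval (eval_int_poly k e) a) <->
    eval (intr : int -> K) b.
Proof.
elim: k a => [|k IHk] a; first by exists a => K; split=> [[]|]; last exists [::].
have [b bP] := eliminate_exists a; have [c cP] := IHk b.
exists c => K; rewrite -cP; split=> -[e].
  by move=> ea; exists (behead e); apply/bP; exists (head 0 e).
by case/bP => x xa; exists (x :: e).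
Qed.


(** * Boolean algebra of conditions on the characteristic *)

Definition char_definable (P : closedFieldType -> Prop) : Prop :=
  exists S : {fset nat}, (forall p, p \in S -> prime p) /\
    ((forall K, P K <-> char_in K S) \/ (forall K, P K <-> ~ char_in K S)).

(** Searching the finite set [S] decides membership; this instance of excluded middle is what
    closure under negation rests on. *)
Lemma char_inP (K : fieldType) (S : {fset nat}) : char_in K S \/ ~ char_in K S.
Proof.
have [/hasP[p pS pK]|/hasPn noS] := boolP (has (mem [pchar K]) S).
  by left; exists p.
by right=> -[p pS]; apply/negP/noS.
Qed.

Lemma eq_char_definable (P Q : closedFieldType -> Prop) :
  (forall K, P K <-> Q K) -> char_definable P -> char_definable Q.
Proof.
by move=> PQ [S [prS PS]]; exists S; split=> //; case: PS => PS;
  [left|right] => K; rewrite -PQ.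
Qed.

Lemma char_definableN (P : closedFieldType -> Prop) :
  char_definable P -> char_definable (fun K => ~ P K).
Proof.
case=> S [prS PS]; exists S; split=> //; case: PS => PS; [right|left] => K;
  have := char_inP K S; have := PS K; tauto.
Qed.

(** A field has at most one prime characteristic, so the witnesses in [S] and [T] coincide. *)
Lemma char_in_fsetI (K : fieldType) (S T : {fset nat}) :
  char_in K (S `&` T)%fset <-> char_in K S /\ char_in K T.
Proof.
split=> [[p]|[[p pS pK] [q qT qK]]].
  by rewrite in_fsetI => /andP[pS pT] pK; split; exists p.
exists p => //; rewrite in_fsetI pS.
by move: qK; rewrite (pcharf_eq pK) => /eqP <-.
Qed.

Lemma char_in_fsetU (K : fieldType) (S T : {fset nat}) :
  char_in K (S `|` T)%fset <-> char_in K S \/ char_in K T.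
Proof.
split=> [[p]|[] [p pS pK]]; last 2 first.
- by exists p => //; rewrite in_fsetU pS.
- by exists p => //; rewrite in_fsetU pS orbT.
by rewrite in_fsetU => /orP[] pS pK; [left|right]; exists p.
Qed.

Lemma char_in_fsetD (K : fieldType) (S T : {fset nat}) :
  char_in K (S `\` T)%fset <-> char_in K S /\ ~ char_in K T.
Proof.
split=> [[p]|[[p pS pK] KT]].
  rewrite in_fsetD => /andP[pT pS] pK; split; first by exists p.
  by case=> q qT; rewrite (pcharf_eq pK) => /eqP qp; rewrite -qp qT in pT.
by exists p => //; rewrite in_fsetD pS andbT; apply/negP => pT; apply: KT; exists p.
Qed.

Lemma char_definableI (P Q : closedFieldType -> Prop) :
  char_definable P -> char_definable Q ->
  char_definable (fun K => P K /\ Q K).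
Proof.
case=> S [prS PS] [T [prT QT]].
case: PS QT => PS [] QT.
- exists (S `&` T)%fset; split=> [p|]; first by rewrite in_fsetI => /andP[/prS].
  by left=> K; rewrite char_in_fsetI PS QT.
- exists (S `\` T)%fset; split=> [p|]; first by rewrite in_fsetD => /andP[_ /prS].
  by left=> K; rewrite char_in_fsetD PS QT.
- exists (T `\` S)%fset; split=> [p|]; first by rewrite in_fsetD => /andP[_ /prT].
  by left=> K; rewrite char_in_fsetD PS QT; tauto.
- exists (S `|` T)%fset; split=> [p|]; first by rewrite in_fsetU => /orP[/prS|/prT].
  by right=> K; rewrite char_in_fsetU PS QT; tauto.
Qed.

Lemma char_definable_intr_eq0 (c : int) :
  char_definable (fun K => (c%:~R : K) == 0).
Proof.
have [->|c0] := eqVneq c 0.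
  exists fset0; split=> [p|]; first by rewrite in_fset0.
  by right=> K; rewrite eqxx; split=> // _ [p]; rewrite in_fset0.
have c_gt0 : (0 < `|c|)%N by rewrite absz_gt0.
have cE (K : fieldType) : ((c%:~R : K) == 0) = ((`|c|%N%:R : K) == 0).
  by rewrite {1}[c]intEsign rmorphM rmorph_sign mulf_eq0 signr_eq0.
exists [fset p in primes `|c|]%fset; split=> [p|].
  by rewrite inE /= mem_primes => /andP[].
left=> K; rewrite cE; split=> [cK|[p]].
  have [p pK] := natf0_pchar c_gt0 cK; exists p => //.
  by rewrite inE /= mem_primes (pcharf_prime pK) c_gt0 (dvdn_pcharf pK).
by rewrite inE /= mem_primes => /and3P[_ _ pc] pK; rewrite -(dvdn_pcharf pK).
Qed.

Lemma char_definable_form (b : form int) :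
  char_definable (fun K => eval (intr : int -> K) b).
Proof.
elim: b => [c|c|a IHa b IHb|a IHa b IHb].
- exact: char_definable_intr_eq0.
- apply: eq_char_definable (char_definableN (char_definable_intr_eq0 c)) => K.
  by split=> /negP.
- apply: eq_char_definable (char_definableI IHa IHb) => K /=.
  by split=> /andP.
(* Disjunction is obtained by De Morgan from negation and conjunction. *)
- apply: eq_char_definable (char_definableN
    (char_definableI (char_definableN IHa) (char_definableN IHb))) => K /=.
  split=> [nab|/orP[ab|ab] [na nb] //].
  apply/negPn/negP; rewrite negb_or => /andP[/negP na /negP nb].
  exact: nab.
Qed.

(** * The product of two polynomials with unknown coefficients *)

Section GenericProduct.
Variables (n d : nat) (I : {fset 'X_{1..n}}).

(** The unknown coefficients of the first factor are numbered before those of the second, so a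
    valuation is the concatenation of two coefficient lists. *)
Definition varA (m : 'X_{1..n < d}) : nat := enum_rank m.
Definition varB (m : 'X_{1..n < d}) : nat := (#|{: 'X_{1..n < d}}| + enum_rank m)%N.
Definition nvars : nat := (#|{: 'X_{1..n < d}}| + #|{: 'X_{1..n < d}}|)%N.

Lemma varA_lt m : (varA m < nvars)%N.
Proof. by rewrite /varA /nvars ltn_addr. Qed.

Lemma varB_lt m : (varB m < nvars)%N.
Proof. by rewrite /varB /nvars ltn_add2l. Qed.

Definition mpoly_of (K : fieldType) (index : 'X_{1..n < d} -> nat) (e : seq K) :
  {mpoly K[n]} := \sum_(m : 'X_{1..n < d}) e`_(index m) *: 'X_[m].

Definition product_coef (m : 'X_{1..n}) : int_poly nvars :=
  \sum_(k : 'X_{1..n < d, d} | m == (k.1 + k.2)%MM)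
    var nvars (varA k.1) * var nvars (varB k.2).

Lemma eval_product_coef (K : fieldType) (e : seq K) (m : 'X_{1..n}) :
  eval_int_poly nvars e (product_coef m) = (mpoly_of varA e * mpoly_of varB e)@_m.
Proof.
rewrite rmorph_sum /mpoly_of big_distrlr /= pair_bigA /= raddf_sum /=.
rewrite big_mkcond; apply: eq_bigr => k _.
rewrite rmorphM /= !eval_var ?varA_lt ?varB_lt //.
rewrite -scalerAl -scalerAr scalerA -mpolyXD mcoeffZ mcoeffX [_ == m]eq_sym.
by case: eqP => _; rewrite ?mulr1 ?mulr0.
Qed.

Definition nonconstant_form (index : 'X_{1..n < d} -> nat) : form (int_poly nvars) :=
  big_or [seq Neq0 (var nvars (index m)) |
    m <- enum {: 'X_{1..n < d}} & bmnm m != 0%MM].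

(** Only sums of two monomials of degree less than [d] can occur in the product. Appending [I] makes
    the formula false when some element of [I] is no such sum. *)
Definition product_form : form (int_poly nvars) :=
  big_and [seq if m \in I then Neq0 (product_coef m) else Eq0 (product_coef m) |
    m <- [seq (bmnm k.1 + bmnm k.2)%MM | k <- enum {: 'X_{1..n < d, d}}] ++ I].

Lemma mcoeff_mpoly_of (K : fieldType) index (e : seq K) (m : 'X_{1..n < d}) :
  (mpoly_of index e)@_m = e`_(index m).
Proof.
rewrite /mpoly_of raddf_sum (bigD1 m) //= big1 => [|k ne_km].
  by rewrite mcoeffZ mcoeffX eqxx mulr1 addr0.
by rewrite mcoeffZ mcoeffX -(inj_eq val_inj) in ne_km *; rewrite (negPf ne_km) mulr0.
Qed.

Lemma mpoly_of_coefs (K : fieldType) (index : 'X_{1..n < d} -> nat) (e : seq K)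
  (P : {mpoly K[n]}) :
  (msize P <= d)%N -> (forall m, e`_(index m) = P@_m) -> mpoly_of index e = P.
Proof.
by move=> ltPd eP; rewrite [RHS](mpolywE ltPd); apply: eq_bigr => m _; rewrite eP.
Qed.

Lemma mcoeff_mpoly_of_large (K : fieldType) index (e : seq K) (m : 'X_{1..n}) :
  (d <= mdeg m)%N -> (mpoly_of index e)@_m = 0.
Proof.
move=> le_dm; rewrite /mpoly_of raddf_sum big1 //= => k _.
rewrite mcoeffZ mcoeffX; case: eqP => [km|_]; last by rewrite mulr0.
by have := bmdeg k; rewrite km ltnNge le_dm.
Qed.

Lemma nonconstant_formP (K : fieldType) index (e : seq K) :
  (forall m, (index m < nvars)%N) ->
  eval (eval_int_poly nvars e) (nonconstant_form index) <->
  nonconstant (mpoly_of index e).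
Proof.
move=> lt_index; rewrite /nonconstant_form eval_big_or has_map; split=> [/hasP[m]|nc].
  rewrite mem_filter /= eval_var // => /andP[m0 _] em [c /(congr1 (mcoeff m))].
  by rewrite mcoeff_mpoly_of mcoeffC (negPf m0) mulr0 => /eqP; rewrite (negPf em).
apply/hasPn => all0; apply: nc; exists (mpoly_of index e)@_0.
apply/mpolyP => m; rewrite mcoeffC; have [->|m0] := eqVneq m 0%MM.
  by rewrite mulr1.
rewrite mulr0; have [lt_md|] := ltnP (mdeg m) d; last exact: mcoeff_mpoly_of_large.
rewrite (mcoeff_mpoly_of _ _ (BMultinom lt_md)); apply/eqP/negPn.
have := all0 (BMultinom lt_md); rewrite mem_filter mem_enum /= m0 eval_var //.
exact.
Qed.

Lemma product_formP (K : fieldType) (e : seq K) :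
  eval (eval_int_poly nvars e) product_form <->
  has_support I (mpoly_of varA e * mpoly_of varB e).
Proof.
have evalE m : eval (eval_int_poly nvars e)
    (if m \in I then Neq0 (product_coef m) else Eq0 (product_coef m)) =
  ((m \in msupp (mpoly_of varA e * mpoly_of varB e)) == (m \in I)).
  by rewrite mcoeff_msupp -eval_product_coef; case: ifP => /= _; case: eqP.
rewrite /product_form eval_big_and all_map; split=> [/allP eI m|eI].
  have [/eI|] := boolP (m \in [seq (bmnm k.1 + bmnm k.2)%MM |
      k <- enum {: 'X_{1..n < d, d}}] ++ I); first by rewrite /= evalE => /eqP.
  (* Off the tested list, the monomial is outside [I] and its coefficient in the product is an empty
     sum. *)
  rewrite mem_cat negb_or => /andP[mAB /negPf mI]; rewrite [RHS]mI.
  apply/negP; rewrite mcoeff_msupp -eval_product_coef /product_coef.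
  rewrite big1 ?rmorph0 ?eqxx //.
  move=> k /eqP mE; case/negP: mAB; apply/mapP; exists k => //.
  by rewrite mem_enum.
by apply/allP => m _ /=; rewrite evalE; apply/eqP/eI.
Qed.

End GenericProduct.

(** * Reducibility with given support as a formula, and the conclusion *)

Lemma nonconstant_neq0 (n : nat) (K : fieldType) (P : {mpoly K[n]}) :
  nonconstant P -> P != 0.
Proof. by move=> ncP; apply/eqP => P0; apply: ncP; exists 0; rewrite P0 mpolyC0. Qed.

Lemma leq_msizeM (n : nat) (K : fieldType) (P Q : {mpoly K[n]}) :
  P != 0 -> Q != 0 -> (msize P <= msize (P * Q))%N.
Proof.
move=> P0 Q0; rewrite msizeM //.
by have := Q0; rewrite -msize_poly_eq0 -lt0n; case: (msize Q) => // k _;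
  rewrite addnS leq_addr.
Qed.

Lemma Z_nonempty_form (n : nat) (I : {fset 'X_{1..n}}) :
  exists k (a : form (int_poly k)), forall K : fieldType,
    (exists e : seq K, eval (eval_int_poly k e) a) <->
    (exists P : {mpoly K[n]}, Z I P).
Proof.
(* This is the [msize] of every polynomial with support [I], whatever the field; it strictly exceeds
   the degrees of both factors. *)
pose d := (\max_(m <- I) (mdeg m).+1)%N.
exists (nvars n d), (And (product_form d I)
  (And (nonconstant_form (@varA n d)) (nonconstant_form (@varB n d)))) => K.
split=> [[e /= /andP[/product_formP sAB /andP[]]]|].
  move=> /(nonconstant_formP _ (@varA_lt n d)) ncA.
  move=> /(nonconstant_formP _ (@varB_lt n d)) ncB.
  exists (mpoly_of (@varA n d) e * mpoly_of (@varB n d) e); split=> //.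
  by exists (mpoly_of (@varA n d) e), (mpoly_of (@varB n d) e).
case=> P [sP [A [B [ncA ncB PE]]]]; rewrite PE in sP.
have [A0 B0] := (nonconstant_neq0 ncA, nonconstant_neq0 ncB).
have szAB : msize (A * B) = d.
  by rewrite msizeE; apply: perm_big; rewrite uniq_perm ?msupp_uniq ?fset_uniq.
have szA : (msize A <= d)%N by rewrite -szAB leq_msizeM.
have szB : (msize B <= d)%N by rewrite -szAB mulrC leq_msizeM.
(* The coefficients are listed in the order of [enum_rank], as the numbering of the unknowns
   requires. *)
pose coefs (Q : {mpoly K[n]}) := [seq Q@_(bmnm m) | m <- enum {: 'X_{1..n < d}}].
have nth_coefs Q (m : 'X_{1..n < d}) : (coefs Q)`_(enum_rank m) = Q@_m.
  by rewrite (nth_map m) ?nth_enum_rank // -cardE.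
have size_coefs Q : size (coefs Q) = #|{: 'X_{1..n < d}}| by rewrite size_map -cardE.
have EA : mpoly_of (@varA n d) (coefs A ++ coefs B) = A.
  by apply: mpoly_of_coefs => // m; rewrite nth_cat size_coefs ltn_ord nth_coefs.
have EB : mpoly_of (@varB n d) (coefs A ++ coefs B) = B.
  apply: mpoly_of_coefs => // m.
  by rewrite nth_cat size_coefs ltnNge leq_addr /= /varB addKn nth_coefs.
exists (coefs A ++ coefs B); apply/and3P; split.
- by apply/product_formP; rewrite EA EB.
- by apply/(nonconstant_formP _ (@varA_lt n d)); rewrite EA.
- by apply/(nonconstant_formP _ (@varB_lt n d)); rewrite EB.
Qed.

Theorem theorem4p1 (n : nat) (n_ge1 : (1 <= n)%N)
    (I : {fset 'X_{1..n}}) (I_nonempty : I <> fset0) :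
  exists S : {fset nat},
    (forall p : nat, p \in S -> prime p) /\
    ((forall K : closedFieldType, Z_empty I K <-> char_in K S) \/
     (forall K : closedFieldType, Z_empty I K <-> ~ char_in K S)).
Proof.
have [k [a aP]] := Z_nonempty_form I; have [b bP] := eliminate_all a.
(* The formula [b] expresses nonemptiness, hence the complement. *)
apply: eq_char_definable (char_definableN (char_definable_form b)) => K.
rewrite -bP aP; split=> [noP P ZP|noP [P ZP]]; first by apply: noP; exists P.
exact: noP ZP.
Qed.
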